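(* Let $p$ be a prime, let $\ell$ be a prime different from $p$, let $a\geq 1$, and let $m=\ell^a$. Assume that the cyclotomic polynomial $\Phi_m(X)\in\mathbb{Z}[X]$ remains irreducible modulo $p$. Then $W_p(m)=\mathbb{N}p+\mathbb{N}\ell=\{bp+c\ell: b,c\in\mathbb{N}\}$, where $\mathbb{N}=\{0,1,2,\dots\}$.
   Context: For a prime $p$ and a positive integer $m$, $W_p(m)$ denotes the set of integers $n\geq 0$ for which there exist $\alpha_1,\dots,\alpha_n\in\overline{\mathbb{F}}_p$ with $\alpha_i^m=1$ for all $i$ (repetitions allowed) and $\alpha_1+\cdots+\alpha_n=0$ (so $0\in W_p(m)$). *)

(* Defs.v *)
From HB Require Import structures.
From mathcomp Require Import all_boot all_order all_algebra all_field.

Set Implicit Arguments.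
Unset Strict Implicit.
Unset Printing Implicit Defensive.

Import GRing.Theory.
Local Open Scope ring_scope.

(* [is_alg_closure iota]: the closed field K is an algebraic closure of F along
   iota, i.e. every element of K is algebraic over F (over a field, integral and
   algebraic coincide; the closedness is part of the type of K).
   Such a K exists for every prime field by [countable_algebraic_closure]. *)
Definition is_alg_closure (F : fieldType) (K : closedFieldType)
  (iota : {rmorphism F -> K}) : Prop := integralRange iota.

(* [W K m n] means n \in W_p(m), where K is an algebraic closure of 'F_p. *)
Definition W (K : closedFieldType) (m n : nat) : Prop :=
  exists alpha : 'I_n -> K,
    (forall i, alpha i ^+ m = 1) /\ \sum_(i < n) alpha i = 0.

Definition Cyclotomic_mod (p m : nat) : {poly 'F_p} :=
  map_poly (intr : int -> 'F_p) 'Phi_m.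

(* Main.v *)
Require Import Defs.
From HB Require Import structures.
From mathcomp Require Import all_boot all_order all_algebra all_field.

Set Implicit Arguments.
Unset Strict Implicit.
Unset Printing Implicit Defensive.

Import GRing.Theory.
Local Open Scope ring_scope.

(* Put q = l^(a-1) and m = l^a. A vanishing sum of n powers of a primitive m-th
   root of unity zeta gives f = sum_i X^(e_i) over F_p with f(zeta) = 0, so
   Phi_m divides f by irreducibility. As (X^q - 1) Phi_m = X^m - 1, the
   multiplicity N_k of zeta^k in the sum is q-periodic in k modulo p. Hence
   n = sum_k N_k is l * sum_(r < q) (N_r mod p) plus a multiple of p. *)

(** The divisors of l^(a+1) are those of l^a together with l^(a+1) itself, so the factorizations of
    the two binomials into cyclotomic polynomials differ by a single factor. *)
Lemma Cyclotomic_pfactor_mul (l a : nat) : prime l ->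
  'Phi_(l ^ a.+1) * ('X^(l ^ a) - 1) = 'X^(l ^ a.+1) - 1.
Proof.
move=> pr_l.
have l_gt0 b : (0 < l ^ b)%N by rewrite expn_gt0 prime_gt0.
rewrite -!prod_Cyclotomic //.
have eq_div : perm_eq (divisors (l ^ a.+1)) (l ^ a.+1 :: divisors (l ^ a))%N.
  apply: uniq_perm; first exact: divisors_uniq.
    rewrite cons_uniq divisors_uniq -dvdn_divisors //.
    by rewrite andbT gtnNdvd // ltn_exp2l ?prime_gt1.
  move=> d; rewrite inE -!dvdn_divisors //; apply/idP/idP.
    case/(dvdn_pfactor _ _ pr_l) => b; rewrite leq_eqVlt => /predU1P[-> -> |].
      by rewrite eqxx.
    by rewrite ltnS => le_b ->; rewrite dvdn_exp2l ?orbT.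
  by case/predU1P=> [-> // | d_dv]; rewrite expnSr dvdn_mulr.
by rewrite (perm_big _ eq_div) big_cons.
Qed.

(** Comparing degrees gives deg u < q. At degree k + q < m the left side has coefficient f_k -
    f_(k+q), and the right side has -u_(k+q) = 0. *)
Lemma coef_periodic (R : idomainType) (q m : nat) (f : {poly R}) (k : nat) :
    (0 < m)%N -> (size f <= m)%N ->
    (exists u, f * ('X^q - 1) = u * ('X^m - 1)) ->
  (k + q < m)%N -> f`_(k + q) = f`_k.
Proof.
move=> m_gt0 sz_f [u eq_u] lt_kq.
have sz_u : (size u <= q)%N.
  have [-> | u_neq0] := eqVneq u 0; first by rewrite size_poly0.
  have := congr1 (fun g : {poly R} => size g) eq_u.
  rewrite (size_Mmonic u_neq0) ?monicXnsubC // size_XnsubC //.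
  rewrite addnS /= => sz_eq; rewrite -(leq_add2r m) -sz_eq mulrBr mulr1.
  rewrite (leq_trans (size_polyD _ _)) // size_polyN geq_max addnC.
  rewrite (leq_trans (size_polyMleq _ _)) ?size_polyXn ?addnS ?leq_add2r //=.
  exact: leq_trans sz_f (leq_addr _ _).
have := congr1 (fun g : {poly R} => g`_(k + q)) eq_u.
rewrite !mulrBr !mulr1 !coefB !coefMXn lt_kq ltnNge leq_addl /= addnK sub0r.
rewrite [u`__]nth_default ?(leq_trans sz_u) ?leq_addl // oppr0 => /eqP.
by rewrite subr_eq0 => /eqP.
Qed.

Lemma sum_periodic (g : nat -> nat) (q l : nat) :
    (forall k, (k + q < l * q)%N -> g (k + q)%N = g k) ->
  (\sum_(0 <= k < l * q) g k = l * \sum_(0 <= k < q) g k)%N.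
Proof.
elim: l => [|l IHl] g_per; first by rewrite !mul0n big_geq.
have g_per' k : (k < q)%N -> forall j, (j <= l)%N -> g (k + j * q)%N = g k.
  move=> lt_kq; elim=> [|j IHj] lt_jl; first by rewrite addn0.
  rewrite mulSnr addnA g_per; first exact/IHj/ltnW.
  by rewrite -addnA -mulSnr -addSn [leqRHS]mulSn leq_add // leq_mul.
rewrite mulSnr (big_cat_nat _ (n := (l * q)%N)) ?leq_addr //= mulSnr; congr addn.
  by apply: IHl => k lt_k; apply: g_per; rewrite mulSn ltn_addl.
(* The last block of q indices is shifted down to [0, q), where [g_per'] applies. *)
rewrite -[X in \sum_(X <= _ < _) _]add0n big_addn addKn big_nat_cond.
rewrite [RHS]big_nat_cond.
by apply: eq_bigr => k; rewrite andbT => /andP[_ lt_kq]; rewrite g_per'.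
Qed.

(** The gcd commutes with field extension, so [gcdp f g] still vanishes at [x]. It is therefore not
    constant, and irreducibility makes it associate to [f]. *)
Lemma irreducible_dvdp_root (F : fieldType) (K : fieldType)
    (iota : {rmorphism F -> K}) (f g : {poly F}) (x : K) :
    irreducible_poly f -> root (map_poly iota f) x ->
  root (map_poly iota g) x -> f %| g.
Proof.
move=> [_ irr_f] fx0 gx0.
have dx0 : root (map_poly iota (gcdp f g)) x by rewrite gcdp_map root_gcd fx0.
have /(irr_f _)/(_ (dvdp_gcdl f g)) : size (gcdp f g) != 1.
  apply/negP => /size_poly1P[c c_neq0 d_eq]; move: dx0.
  by rewrite d_eq map_polyC rootC fmorph_eq0 (negPf c_neq0).
by rewrite /eqp => /andP[_ /dvdp_trans]; apply; apply: dvdp_gcdr.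
Qed.

Lemma W0 (K : closedFieldType) (m : nat) : W K m 0.
Proof. by exists (fun=> 0); split=> [[]|] //; rewrite big_ord0. Qed.

Lemma W_add (K : closedFieldType) (m n1 n2 : nat) :
  W K m n1 -> W K m n2 -> W K m (n1 + n2).
Proof.
move=> [s [s1 s0]] [t [t1 t0]].
exists (fun i => match split i with inl j => s j | inr j => t j end); split.
  by move=> i; case: split.
rewrite big_split_ord /=.
transitivity (\sum_i s i + \sum_i t i); last by rewrite s0 t0 addr0.
congr (_ + _).
  by apply: eq_bigr => i _; rewrite (unsplitK (inl _ i)).
by apply: eq_bigr => i _; rewrite (unsplitK (inr _ i)).
Qed.

Lemma W_mul (K : closedFieldType) (m n b : nat) : W K m n -> W K m (b * n).
Proof.
by move=> Wn; elim: b => [|b IHb]; [apply: W0 | rewrite mulSn; apply: W_add].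
Qed.

Lemma W_pchar (K : closedFieldType) (m p : nat) : p%:R = 0 :> K -> W K m p.
Proof.
move=> p0; exists (fun=> 1); split=> [i|]; first exact: expr1n.
by rewrite sumr_const card_ord.
Qed.

(** The l powers of z^q, which has order l, form a geometric sum; multiplied by z^q - 1 != 0 it
    becomes z^(l q) - 1 = 0. *)
Lemma W_primitive (K : closedFieldType) (q l : nat) (z : K) :
  (0 < q)%N -> (1 < l)%N -> (l * q).-primitive_root z -> W K (l * q) l.
Proof.
move=> q_gt0 l_gt1 z_prim; exists (fun i => (z ^+ q) ^+ i); split=> [i|].
  by rewrite -!exprM mulnA mulnC exprM (prim_expr_order z_prim) expr1n.
have zq1 : z ^+ q - 1 != 0.
  rewrite subr_eq0 -(prim_order_dvd z_prim) gtnNdvd //.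
  by rewrite -[ltnLHS]mul1n ltn_pmul2r.
apply: (mulfI zq1); rewrite -subrX1 mulr0 -exprM mulnC.
by rewrite (prim_expr_order z_prim) subrr.
Qed.

(** If z^q = 1 also held, z would be a double root of X^m - 1 = Phi_m (X^q - 1), which is separable
    since p does not divide m. So the order of z divides l^(a+1) but not l^a. *)
Lemma Cyclotomic_mod_primitive (p l a : nat) (K : closedFieldType)
    (iota : {rmorphism 'F_p -> K}) (z : K) :
    prime p -> prime l -> l != p ->
    root (map_poly iota (Cyclotomic_mod p (l ^ a.+1))) z ->
  (l ^ a.+1).-primitive_root z.
Proof.
move=> pr_p pr_l neq_lp Phi_z.
set q := (l ^ a)%N; set m := (l ^ a.+1)%N.
have m_gt0 : (0 < m)%N by rewrite expn_gt0 prime_gt0.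
have eqK : map_poly iota (Cyclotomic_mod p m) * ('X^q - 1) = 'X^m - 1.
  have := congr1 (map_poly (iota \o intr)) (Cyclotomic_pfactor_mul a pr_l).
  rewrite rmorphM !rmorphB !rmorph1 /= !map_polyXn => <-; congr (_ * _).
  by rewrite /Cyclotomic_mod -map_poly_comp.
have zm1 : z ^+ m = 1.
  have := congr1 (fun g : {poly K} => g.[z]) eqK.
  rewrite hornerM (rootP Phi_z) mul0r !hornerE => /esym/eqP.
  by rewrite subr_eq0 => /eqP.
have zq1 : z ^+ q != 1.
  apply/negP => /eqP zq1.
  have := congr1 (fun g : {poly K} => (deriv g).[z]) eqK.
  rewrite derivM !derivB !derivXn -[1]/(1%:P) derivC !hornerE.
  rewrite (rootP Phi_z) zq1 subrr mulr0 mul0r addr0 hornerMn hornerXn => /esym.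
  (* Multiplying m z^(m-1) = 0 by z and using z^m = 1 leaves m = 0 in K, which forces p = l. *)
  move=> /(congr1 (fun y => y * z)).
  rewrite subr0 mul0r mulrnAl -exprSr prednK //.
  rewrite zm1 -(rmorph_nat iota) => /eqP; rewrite fmorph_eq0 natrX expf_eq0.
  rewrite -(dvdn_pcharf (pchar_Fp pr_p)) dvdn_prime2 // eq_sym => /andP[_].
  exact/negP.
have [k k_prim] := prim_order_exists m_gt0 zm1.
case/(dvdn_pfactor _ _ pr_l) => b; rewrite leq_eqVlt => /predU1P[-> def_k|].
  by rewrite def_k in k_prim.
rewrite ltnS => le_ba def_k; case/eqP: zq1.
by apply/eqP; rewrite -(prim_order_dvd k_prim) def_k dvdn_exp2l.
Qed.

Theorem theorem2p6 (p l a : nat) (K : closedFieldType)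
  (iota : {rmorphism 'F_p -> K}) (hK : is_alg_closure iota)
  (hp : prime p) (hl : prime l) (hlp : l <> p) (ha : (1 <= a)%N)
  (hirr : irreducible_poly (Cyclotomic_mod p (l ^ a)%N)) :
  forall n : nat,
    W K (l ^ a)%N n <-> exists b c : nat, n = (b * p + c * l)%N.
Proof.
(* From here on m is [l ^ a.+1] and q is [l ^ a]. *)
case: a ha hirr => // a _ hirr n.
have /closed_rootP[z Phi_z] :
    size (map_poly iota (Cyclotomic_mod p (l ^ a.+1))) != 1.
  by rewrite size_map_poly; case: hirr => + _; case: size => [|[]].
have neq_lp : l != p by apply/eqP.
have z_prim := Cyclotomic_mod_primitive hp hl neq_lp Phi_z.
have q_gt0 : (0 < l ^ a)%N by rewrite expn_gt0 prime_gt0.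
have m_gt0 : (0 < l ^ a.+1)%N by rewrite expn_gt0 prime_gt0.
split=> [[alpha [alpha1 alpha0]] | [b [c ->]]]; last first.
  apply: W_add; apply: W_mul.
    by apply: W_pchar; rewrite -(rmorph_nat iota) pchar_Fp_0 ?rmorph0.
  rewrite expnS; apply: W_primitive q_gt0 (prime_gt1 hl) _.
  by rewrite -expnS; exact: z_prim.
have /fin_all_exists[e alphaE] i : exists k : 'I_(l ^ a.+1), alpha i = z ^+ k.
  by have [k ->] := prim_rootP z_prim (alpha1 i); exists k.
pose f : {poly 'F_p} := \sum_(i < n) 'X^(e i).
(* The multiplicities are kept as naturals; [f] only sees their residues mod p. *)
pose N (k : nat) := (\sum_(i < n) (k == e i :> nat))%N.
have fE k : f`_k = (N k)%:R.
  by rewrite coef_sum natr_sum; apply: eq_bigr => i _; rewrite coefXn.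
have Phi_f : Cyclotomic_mod p (l ^ a.+1) %| f.
  apply: (irreducible_dvdp_root hirr Phi_z); apply/rootP.
  rewrite rmorph_sum horner_sum -[RHS]alpha0; apply: eq_bigr => i _.
  by rewrite /= map_polyXn hornerXn alphaE.
have sz_f : (size f <= l ^ a.+1)%N.
  apply/(leq_trans (size_sum _ _ _))/bigmax_leqP => i _.
  by rewrite size_polyXn.
have f_per : exists u, f * ('X^(l ^ a) - 1) = u * ('X^(l ^ a.+1) - 1).
  have /dvdpP[u ->] := Phi_f; exists u; rewrite -mulrA; congr (_ * _).
  have := congr1 (map_poly (intr : int -> 'F_p)) (Cyclotomic_pfactor_mul a hl).
  by rewrite rmorphM !rmorphB !rmorph1 /= !map_polyXn.
have N_per k : (k + l ^ a < l * l ^ a)%N -> (N (k + l ^ a) %% p = N k %% p)%N.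
  rewrite -expnS => /(coef_periodic m_gt0 sz_f f_per); rewrite !fE.
  by move/(congr1 val); rewrite /= !val_Fp_nat.
(* Double counting: each index i is counted by exactly one exponent k, namely [e i]. *)
have n_eq : n = (\sum_(0 <= k < l * l ^ a) N k)%N.
  rewrite -expnS big_mkord exchange_big /= -[LHS]card_ord -sum1_card.
  apply: eq_bigr => i _; rewrite (bigD1 (e i)) //= eqxx big1 // => k.
  by rewrite -val_eqE => /negPf->.
(* Each [N k] is divided by p: the quotients are summed over all exponents, the remainders over a
   single period, which occurs l times. *)
exists (\sum_(0 <= k < l * l ^ a) N k %/ p)%N.
exists (\sum_(0 <= k < l ^ a) N k %% p)%N.
rewrite [(_ * l)%N]mulnC -(sum_periodic N_per) big_distrl -big_split /= {1}n_eq.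
by apply: eq_bigr => k _; exact: divn_eq.
Qed.
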